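(* It is not true in general that every biharmonic homogeneous polynomial is a sum of two components of the form $I_k+\underline{x}_\varphi I_{k-2}\,\underline{x}_\psi$. Precisely, the following assertion is false: for every positive integer $m$, all structural sets $\varphi,\psi$ of $\mathbb{R}^m$ and every integer $k\ge 2$, each $B_k\in\mathcal{B}(k)$ admits a unique decomposition $$B_k=I_k+\underline{x}_\varphi\, I_{k-2}\,\underline{x}_\psi,\qquad I_k\in\mathcal{I}_{\varphi,\psi}(k),\quad I_{k-2}\in\mathcal{I}_{\varphi,\psi}(k-2).$$
   Context: Let $\mathbb{R}_{0,m}$ be the $2^m$-dimensional real associative Clifford algebra generated by the orthonormal basis $e_1,\dots,e_m$ of $\mathbb{R}^m$ with relations $e_je_i+e_ie_j=-2\delta_{ji}$; $\mathbb{R}^m$ is identified with the span of $e_1,\dots,e_m$ in $\mathbb{R}_{0,m}$. A structural set is an (ordered) orthonormal basis $\varphi=\{\varphi_1,\dots,\varphi_m\}$ of $\mathbb{R}^m\subset\mathbb{R}_{0,m}$. For structural sets $\varphi,\psi$ and $(x_1,\dots,x_m)\in\mathbb{R}^m$, put $\underline{x}_\varphi=\sum_{j=1}^m x_j\varphi_j$ and $\underline{x}_\psi=\sum_{j=1}^m x_j\psi_j$. $\mathcal{P}(k)$ denotes the space of $\mathbb{R}_{0,m}$-valued homogeneous polynomials of degree $k$ in $x_1,\dots,x_m$. With $\Delta_m=\sum_{j=1}^m\partial_{x_j}^2$, let $\mathcal{B}(k)=\{P\in\mathcal{P}(k):\Delta_m^2P=0\}$ be the space of biharmonic polynomials in $\mathcal{P}(k)$.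 Let $$\mathcal{I}_{\varphi,\psi}(k)=\Big\{P\in\mathcal{P}(k):\ \sum_{i,j=1}^m\varphi_i\,(\partial_{x_i}\partial_{x_j}P)\,\psi_j=0\Big\}$$ be the space of $(\varphi,\psi)$-inframonogenic polynomials in $\mathcal{P}(k)$. *)

(* Defs.v *)
From HB Require Import structures.
From mathcomp Require Import all_boot all_order all_algebra.
From mathcomp Require Import mpoly.
From mathcomp Require Import reals.

Set Implicit Arguments.
Unset Strict Implicit.
Unset Printing Implicit Defensive.

Import GRing.Theory.
Local Open Scope ring_scope.

(* The Clifford algebra R_{0,m}, with the real scalars replaced by any R.
   An element is the family of its coordinates
   on the blades e_A = e_{a_1} ... e_{a_r}, A = {a_1 < ... < a_r}. *)
Definition clifford (R : comNzRingType) (m : nat) : Type :=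
  {ffun {set 'I_m} -> R}.

Definition symdiff (m : nat) (A B : {set 'I_m}) : {set 'I_m} :=
  (A :\: B) :|: (B :\: A).

(* e_A e_B = (-1)^s e_{A symdiff B}: sorting the word e_A e_B exchanges one
   pair of distinct generators for each (a, b) in A x B with b < a, and each
   common generator contributes one factor e_a ^ 2 = -1. *)
Definition blade_sign (m : nat) (A B : {set 'I_m}) : nat :=
  \sum_(a in A) \sum_(b in B) (b <= a)%N.

Section CliffordAlgebra.
Variables (R : comNzRingType) (m : nat).
Local Notation Cl := (clifford R m).
Implicit Types (A B C : {set 'I_m}) (x y z : Cl).

HB.instance Definition _ :=
  GRing.Lmodule.copy Cl {ffun {set 'I_m} -> R^o}.

Definition blade A : Cl := [ffun B => (B == A)%:R].

Definition clifford_mul x y : Cl :=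
  \sum_A \sum_B ((-1) ^+ blade_sign A B * (x A * y B)) *: blade (symdiff A B).

Lemma cliffordZE (c : R) x A : (c *: x) A = c * x A.
Proof. by rewrite ffunE. Qed.

Lemma in_symdiff A B a : (a \in symdiff A B) = (a \in A) (+) (a \in B).
Proof. by rewrite !inE; case: (a \in A); case: (a \in B). Qed.

Lemma symdiffC A B : symdiff A B = symdiff B A.
Proof. by apply/setP=> a; rewrite !in_symdiff addbC. Qed.

Lemma symdiffA A B C : symdiff A (symdiff B C) = symdiff (symdiff A B) C.
Proof. by apply/setP=> a; rewrite !in_symdiff addbA. Qed.

Lemma symdiff0 A : symdiff set0 A = A.
Proof. by apply/setP=> a; rewrite in_symdiff inE. Qed.

Lemma odd_symdiff (f : 'I_m -> nat) A B :
  odd (\sum_(a in symdiff A B) f a) =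
  odd (\sum_(a in A) f a) (+) odd (\sum_(a in B) f a).
Proof.
rewrite -oddD (big_mkcond (mem A)) (big_mkcond (mem B)) /= -big_split /=.
rewrite big_mkcond /=.
apply: (big_ind2 (fun p q => odd p = odd q)) => // [p p' q q' h h'|a _].
  by rewrite !oddD h h'.
rewrite in_symdiff; case: (a \in A); case: (a \in B) => //=.
- by rewrite oddD addbb.
- by rewrite addn0.
Qed.

Lemma odd_blade_signl A B C :
  odd (blade_sign (symdiff A B) C) =
  odd (blade_sign A C) (+) odd (blade_sign B C).
Proof. exact: odd_symdiff. Qed.

Lemma odd_blade_signr A B C :
  odd (blade_sign A (symdiff B C)) =
  odd (blade_sign A B) (+) odd (blade_sign A C).
Proof. by rewrite /blade_sign ![\sum_(a in A) _]exchange_big odd_symdiff. Qed.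

Lemma clifford_expand x : x = \sum_A x A *: blade A.
Proof.
apply/ffunP=> B; rewrite sum_ffunE (bigD1 B) //= big1 ?addr0 => [|A neqAB].
  by rewrite !ffunE eqxx [LHS](esym (mulr1 _)).
by rewrite !ffunE eq_sym (negbTE neqAB) [LHS]mulr0.
Qed.

Lemma clifford_mulDl : left_distributive clifford_mul +%R.
Proof.
move=> x y z; rewrite /clifford_mul -big_split; apply: eq_bigr => A _ /=.
rewrite -big_split; apply: eq_bigr => B _ /=.
by rewrite ffunE mulrDl mulrDr scalerDl.
Qed.

Lemma clifford_mulDr : right_distributive clifford_mul +%R.
Proof.
move=> x y z; rewrite /clifford_mul -big_split; apply: eq_bigr => A _ /=.
rewrite -big_split; apply: eq_bigr => B _ /=.
by rewrite ffunE !mulrDr scalerDl.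
Qed.

Lemma clifford_mulZl (c : R) x y :
  c *: clifford_mul x y = clifford_mul (c *: x) y.
Proof.
rewrite /clifford_mul scaler_sumr; apply: eq_bigr => A _.
rewrite scaler_sumr; apply: eq_bigr => B _.
by rewrite scalerA cliffordZE mulrCA (mulrA c).
Qed.

Lemma clifford_mulZr (c : R) x y :
  c *: clifford_mul x y = clifford_mul x (c *: y).
Proof.
rewrite /clifford_mul scaler_sumr; apply: eq_bigr => A _.
rewrite scaler_sumr; apply: eq_bigr => B _.
by rewrite scalerA cliffordZE mulrCA (mulrCA c).
Qed.

Lemma clifford_mul_suml (I : finType) (F : I -> Cl) y :
  clifford_mul (\sum_i F i) y = \sum_i clifford_mul (F i) y.
Proof.
apply: (big_morph (clifford_mul^~ y)) => [u v|]; first exact: clifford_mulDl.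
by apply: (addrI (clifford_mul 0 y)); rewrite -clifford_mulDl !addr0.
Qed.

Lemma clifford_mul_sumr (I : finType) (F : I -> Cl) x :
  clifford_mul x (\sum_i F i) = \sum_i clifford_mul x (F i).
Proof.
apply: (big_morph (clifford_mul x)) => [u v|]; first exact: clifford_mulDr.
by apply: (addrI (clifford_mul x 0)); rewrite -clifford_mulDr !addr0.
Qed.

Lemma clifford_mul_blade A B :
  clifford_mul (blade A) (blade B) =
  (-1) ^+ blade_sign A B *: blade (symdiff A B).
Proof.
rewrite /clifford_mul (bigD1 A) //= (bigD1 B) //= !big1 ?addr0.
- by rewrite !ffunE !eqxx !mulr1.
- move=> A' neqA; rewrite big1 // => B' _.
  by rewrite !ffunE (negbTE neqA) mul0r mulr0 scale0r.
- by move=> B' neqB; rewrite !ffunE (negbTE neqB) !mulr0 scale0r.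
Qed.

Lemma clifford_mulA : associative clifford_mul.
Proof.
have bladeA A B C :
    clifford_mul (blade A) (clifford_mul (blade B) (blade C)) =
    clifford_mul (clifford_mul (blade A) (blade B)) (blade C).
  rewrite !clifford_mul_blade -clifford_mulZr -clifford_mulZl.
  rewrite !clifford_mul_blade !scalerA symdiffA -!exprD; congr (_ *: _).
  rewrite -signr_odd -[RHS]signr_odd !oddD odd_blade_signl odd_blade_signr.
  by congr (_ ^+ nat_of_bool _);
     do 3!case: (odd (blade_sign _ _)).
move=> x y z; rewrite (clifford_expand x).
rewrite 2!(clifford_mul_suml (fun A => x A *: blade A)).
rewrite clifford_mul_suml; apply: eq_bigr => A _.
rewrite -!clifford_mulZl; congr (_ *: _).
rewrite (clifford_expand y) (clifford_mul_suml (fun B => y B *: blade B)).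
rewrite (clifford_mul_sumr (fun B => y B *: blade B)).
rewrite !clifford_mul_suml clifford_mul_sumr; apply: eq_bigr => B _.
rewrite -clifford_mulZl -!clifford_mulZr -clifford_mulZl; congr (_ *: _).
rewrite (clifford_expand z) 2!(clifford_mul_sumr (fun C => z C *: blade C)).
rewrite clifford_mul_sumr; apply: eq_bigr => C _.
by rewrite -!clifford_mulZr bladeA.
Qed.

Lemma clifford_mul1l : left_id (blade set0) clifford_mul.
Proof.
move=> x; rewrite {1}(clifford_expand x) clifford_mul_sumr {2}(clifford_expand x).
apply: eq_bigr => A _; rewrite -clifford_mulZr clifford_mul_blade symdiff0.
by rewrite /blade_sign big_set0 scale1r.
Qed.

Lemma clifford_mul1r : right_id (blade set0) clifford_mul.
Proof.
move=> x; rewrite {1}(clifford_expand x) clifford_mul_suml {2}(clifford_expand x).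
apply: eq_bigr => A _; rewrite -clifford_mulZl clifford_mul_blade symdiffC symdiff0.
by rewrite /blade_sign big1 ?scale1r // => a _; rewrite big_set0.
Qed.

Lemma clifford_1_neq0 : blade set0 != 0 :> Cl.
Proof.
by apply/eqP => /ffunP /(_ set0) /eqP; rewrite !ffunE eqxx oner_eq0.
Qed.

HB.instance Definition _ := GRing.Zmodule_isNzRing.Build Cl
  clifford_mulA clifford_mul1l clifford_mul1r clifford_mulDl clifford_mulDr
  clifford_1_neq0.
HB.instance Definition _ := GRing.Lmodule_isLalgebra.Build R Cl clifford_mulZl.
HB.instance Definition _ := GRing.Lalgebra_isAlgebra.Build R Cl clifford_mulZr.

Definition clifford_gen (i : 'I_m) : Cl := blade [set i].

Lemma clifford_genM (i j : 'I_m) :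
  clifford_gen i * clifford_gen j + clifford_gen j * clifford_gen i =
  (- (2 * (j == i)%:R)) *: 1.
Proof.
have signE (a b : 'I_m) : blade_sign [set a] [set b] = (b <= a)%N.
  by rewrite /blade_sign !big_set1.
rewrite [_ * _]clifford_mul_blade [X in _ + X]clifford_mul_blade !signE.
rewrite (symdiffC [set j]) -scalerDl; have [->|neq_ji] := eqVneq j i.
  rewrite leqnn expr1 mulr1 -opprD; congr (_ *: blade _).
  by apply/setP=> a; rewrite in_symdiff addbb inE.
rewrite mulr0 oppr0 scale0r.
have [lt_ij|lt_ji|/val_inj eq_ij] := ltngtP i j.
- by rewrite expr0 expr1 addrN scale0r.
- by rewrite expr0 expr1 addNr scale0r.
- by rewrite eq_ij eqxx in neq_ji.
Qed.

Lemma bladeE A : blade A = \prod_(i in A) clifford_gen i.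
Proof.
have blade_seq (s : seq 'I_m) : pairwise (relpre val ltn) s ->
    blade [set i in s] = \prod_(i <- s) clifford_gen i.
  elim: s => [|i s IHs] /=; first by rewrite big_nil.
  case/andP=> /allP lt_is /IHs {}IHs; rewrite big_cons -IHs.
  rewrite [RHS]clifford_mul_blade /blade_sign big_set1 big1 ?scale1r.
    congr blade; apply/setP=> a; rewrite in_symdiff !inE.
    have [->|//] := eqVneq a i.
    by case: (boolP (i \in s)) => // /lt_is /=; rewrite ltnn.
  by move=> b; rewrite inE => /lt_is /=; rewrite ltnNge => /negbTE->.
rewrite -[RHS]big_filter -blade_seq; last first.
  rewrite -(pairwise_map val) -sorted_pairwise; last exact: ltn_trans.
  apply: (subseq_sorted ltn_trans (s2 := map val (enum 'I_m))).
    by rewrite map_subseq // [index_enum _]unlock -enumT filter_subseq.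
  by rewrite val_enum_ord iota_ltn_sorted.
by congr blade; apply/setP=> i; rewrite inE mem_filter mem_index_enum andbT.
Qed.

(* R^m as the span of e_1, ..., e_m *)
Definition clifford_vec (u : 'rV[R]_m) : Cl :=
  \sum_(i < m) u 0 i *: clifford_gen i.

End CliffordAlgebra.

(* An ordered orthonormal basis of R^m for the Euclidean inner product. *)
Definition structural_set (R : fieldType) (m : nat) (phi : 'I_m -> 'rV[R]_m) :
    Prop :=
  basis_of fullv [seq phi i | i : 'I_m] /\
  forall i j : 'I_m, (phi i *m (phi j)^T) 0 0 = (i == j)%:R.

(* Multiplication in {mpoly A[m]} for a noncommutative A lets the variables
   commute with the coefficients, so {mpoly clifford R m[m]} is the ring of
   R_{0,m}-valued polynomials in the real variables x_1, ..., x_m. *)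
Notation clifford_poly R m := {mpoly (clifford R m)[m]}.

Section CliffordPolynomials.
Variables (R : fieldType) (m : nat).
Local Notation Pol := (clifford_poly R m).
Implicit Types (phi psi : 'I_m -> 'rV[R]_m) (P : Pol) (k : nat).

Definition xvar phi : Pol := \sum_(j < m) (clifford_vec (phi j))%:MP * 'X_j.

Definition laplacian P : Pol := \sum_(j < m) P^`M(j)^`M(j).

Definition biharmonic k P : Prop :=
  P \is k.-homog /\ laplacian (laplacian P) = 0.

Definition inframonogenic phi psi k P : Prop :=
  P \is k.-homog /\
  \sum_(i < m) \sum_(j < m)
    (clifford_vec (phi i))%:MP * P^`M(j)^`M(i) * (clifford_vec (psi j))%:MP = 0.

End CliffordPolynomials.

(* Main.v *)
Require Import Defs.
From HB Require Import structures.
From mathcomp Require Import all_boot all_order all_algebra.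
From mathcomp Require Import mpoly.
From mathcomp Require Import reals.
From mathcomp Require Import ring ssrAC.

(* The decomposition fails for m = 3, phi = psi = (e_1, e_2, e_3), k = 4 and
   B = x_1^3 x_2 e_2.  Write D P = sum_ij e_i (d_i d_j P) e_j and let < , > be the
   Fischer inner product, for which multiplication P |-> x P x is adjoint to D.
   There is a quadratic N = alpha |x|^2 e_1 + beta x_1 x such that D (x N x) is a
   multiple of x e_1 x.  The functional P |-> <P, x N x> = <D P, N> then vanishes
   on the kernel of D, and also on x J x when D J = 0, because
   <x J x, x N x> = <J, D (x N x)> is proportional to <J, x e_1 x> = <D J, e_1>.
   Its value at B is a nonzero multiple of m - 2, which excludes the decomposition.
   Since <P, x N x> only involves the second derivatives at 0 of the Laplacian
   of P, traced against products of generators, no inner product is needed: the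
   cyclicity of the trace (the coefficient of 1) plays its role. *)

Set Implicit Arguments.
Unset Strict Implicit.
Unset Printing Implicit Defensive.

Import GRing.Theory Num.Theory.
Local Open Scope ring_scope.

(** * The coefficient of 1 as a cyclic trace *)

Section CliffordTrace.
Variables (R : comNzRingType) (m : nat).
Local Notation Cl := (clifford R m).
Implicit Types x y : Cl.

Definition clifford_tr x : R := x set0.

Lemma clifford_tr_is_linear : linear_for *%R clifford_tr.
Proof. by move=> c x y; rewrite /clifford_tr !ffunE. Qed.

HB.instance Definition _ :=
  GRing.isLinear.Build R Cl R *%R clifford_tr clifford_tr_is_linear.

Lemma clifford_tr1 : clifford_tr 1 = 1.
Proof. by rewrite /clifford_tr ffunE eqxx. Qed.

(** The product of the blades on A and B contributes to the coefficient of 1 only when A = B, and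
    then the two orders give the same term. *)
Lemma clifford_trC x y : clifford_tr (x * y) = clifford_tr (y * x).
Proof.
rewrite /clifford_tr [x * y]/(clifford_mul x y) [y * x]/(clifford_mul y x).
rewrite /clifford_mul exchange_big !sum_ffunE; apply: eq_bigr => B _.
rewrite !sum_ffunE; apply: eq_bigr => A _; rewrite !cliffordZE !ffunE.
have [->|neqAB] := eqVneq A B; first by rewrite (mulrC (x B)).
suff neq0 (C D : {set 'I_m}) : C != D -> (set0 == symdiff C D) = false.
  by rewrite !neq0 ?mulr0 // eq_sym.
move=> neqCD; apply/negbTE/negP => /eqP/setP eq0; case/eqP: neqCD; apply/setP => a.
by have := eq0 a; rewrite in_symdiff inE; case: (a \in C); case: (a \in D).
Qed.

End CliffordTrace.

(** * Clifford relations in the form used for rewriting *)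

Section CliffordGenerators.
Variables (R : numFieldType) (m : nat).
Local Notation Cl := (clifford R m).
Local Notation e := (@clifford_gen R m).

Lemma clifford_mulr2I : injective (fun x : Cl => x *+ 2).
Proof.
move=> x y /eqP; rewrite -subr_eq0 -mulrnBl -scaler_nat scaler_eq0 pnatr_eq0 /=.
by rewrite subr_eq0 => /eqP.
Qed.

Lemma clifford_gen_anticomm i j :
  e i * e j = - (e j * e i) - (i == j)%:R *+ 2.
Proof.
apply/eqP; rewrite addrC -subr_eq opprK; apply/eqP.
rewrite clifford_genM eq_sym scaleNr; congr (- _).
by case: eqP => _; rewrite ?mulr1 ?mulr0 ?scale0r ?mul0rn // scaler_nat.
Qed.

End CliffordGenerators.

(** * Sums over anticommuting generators in an abstract ring *)

Section AnticommutingGenerators.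
Variables (A : nzRingType) (m : nat) (e : 'I_m -> A).
Hypotheses (mulr2I : injective (fun x : A => x *+ 2))
  (e_anticomm : forall i j, e i * e j = - (e j * e i) - (i == j)%:R *+ 2).
Implicit Types (x y : A) (F : 'I_m -> A) (T : 'I_m -> 'I_m -> A).

Lemma gen_sqr i : e i * e i = - 1.
Proof.
apply: mulr2I; apply/eqP; rewrite mulr2n {1}e_anticomm eqxx.
by rewrite addrAC addNr add0r mulNrn.
Qed.

(** Each [e j] is carried past [e i] with a change of sign; only j = i leaves a correction. *)
Lemma sum_gen_anticomml i F :
  \sum_j e j * e i * F j = - (e i * \sum_j e j * F j) - F i *+ 2.
Proof.
under eq_bigr => j _ do rewrite e_anticomm mulrBl mulNr -mulrA.
rewrite sumrB sumrN -mulr_sumr; congr (_ - _).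
rewrite (bigD1 i) //= eqxx mulr_natl big1 ?addr0 // => j /negbTE->.
by rewrite mul0rn mul0r.
Qed.

Lemma sum_gen_anticommr i F :
  \sum_j F j * e i * e j = - ((\sum_j F j * e j) * e i) - F i *+ 2.
Proof.
under eq_bigr => j _ do rewrite -mulrA e_anticomm mulrBr mulrN mulrA.
rewrite sumrB sumrN -mulr_suml; congr (_ - _).
rewrite (bigD1 i) //= eqxx mulr_natr big1 ?addr0 // => j.
by rewrite eq_sym => /negbTE->; rewrite mul0rn mulr0.
Qed.

Lemma sum_gen_sqr : \sum_i e i * e i = - m%:R.
Proof.
under eq_bigr do rewrite gen_sqr.
by rewrite sumr_const card_ord mulNrn.
Qed.

(** A symmetric family sees only the symmetric part of the products of two generators. This is the
    algebraic form of the Dirac operator squaring to minus the Laplacian. *)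
Lemma sum_gen_genl T : (forall i j, T i j = T j i) ->
  \sum_i e i * (\sum_j e j * T j i) = - \sum_i T i i.
Proof.
move=> symT; set X := LHS.
(* Anticommuting the two generators reproduces X with the opposite sign, so 2X is known and 2 can be
   cancelled. *)
have eqX : X = - X - (\sum_i T i i) *+ 2.
  rewrite {1}/X; under eq_bigr do rewrite mulr_sumr.
  rewrite exchange_big /= /X -sumrN -sumrMnl -sumrB; apply: eq_bigr => i _.
  rewrite -sum_gen_anticomml; apply: eq_bigr => j _.
  by rewrite mulrA symT.
by apply: mulr2I; rewrite mulr2n {1}eqX addrAC addNr add0r mulNrn.
Qed.

Lemma sum_gen_genr T : (forall i j, T i j = T j i) ->
  \sum_i (\sum_j T i j * e j) * e i = - \sum_i T i i.
Proof.
move=> symT; set X := LHS.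
have eqX : X = - X - (\sum_i T i i) *+ 2.
  rewrite {1}/X; under eq_bigr do rewrite mulr_suml.
  rewrite exchange_big /= /X -sumrN -sumrMnl -sumrB; apply: eq_bigr => i _.
  rewrite -sum_gen_anticommr; apply: eq_bigr => j _.
  by rewrite symT.
by apply: mulr2I; rewrite mulr2n {1}eqX addrAC addNr add0r mulNrn.
Qed.

(** Multiplying the null condition by [e k] on the left and summing over k turns the two left
    generators into minus a trace. For derivatives: if the Dirac operator d satisfies d P d = 0,
    then (Laplacian P) d = - d (d P d) = 0. *)
Lemma sum_trace_genr (T : 'I_m -> 'I_m -> 'I_m -> A) :
    (forall j i k, T j i k = T j k i) ->
    (forall k, \sum_i \sum_j e i * T j i k * e j = 0) ->
  \sum_j (\sum_k T j k k) * e j = 0.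
Proof.
move=> symT T0; transitivity (- \sum_k e k * \sum_i \sum_j e i * T j i k * e j).
  rewrite -[\sum_(j < m) _]opprK -sumrN; congr (- _).
  under eq_bigr => j _ do rewrite -mulNr -sum_gen_genl // mulr_suml.
  rewrite exchange_big; apply: eq_bigr => k _ /=.
  under eq_bigr do rewrite -mulrA mulr_suml.
  by rewrite -mulr_sumr exchange_big.
by rewrite big1 ?oppr0 // => k _; rewrite T0 mulr0.
Qed.

(** Generators are eigenvectors of this map with eigenvalue m - 2, and 1 is one with eigenvalue
    -m. *)
Definition sandwich x := \sum_i e i * x * e i.

Lemma sandwich_gen i : sandwich (e i) = e i *+ m - e i *+ 2.
Proof.
by rewrite /sandwich sum_gen_anticomml sum_gen_sqr mulrN opprK mulr_natr.
Qed.

Variables (R : comNzRingType) (tr : {additive A -> R}).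
Hypothesis trC : forall x y, tr (x * y) = tr (y * x).

(** Cyclicity carries the outer generator around: [sandwich] is self-adjoint for the pairing tr (x
    y). *)
Lemma tr_sandwich x y :
  tr (x * sandwich y) = tr (sandwich x * y).
Proof.
rewrite mulr_sumr mulr_suml !raddf_sum; apply: eq_bigr => i _.
by rewrite /= !mulrA trC !mulrA.
Qed.

Lemma tr_sandwich1 x : tr (sandwich x) = - (tr x *+ m).
Proof.
rewrite -[sandwich x]mul1r tr_sandwich /sandwich.
under eq_bigr do rewrite mulr1.
by rewrite sum_gen_sqr mulNr mulr_natl raddfN raddfMn.
Qed.

(** * Symmetric families killed by the inframonogenic operator *)

Section Symmetric.
Variable J : 'I_m -> 'I_m -> A.
Hypothesis symJ : forall i j, J i j = J j i.
Hypothesis infraJ : \sum_i \sum_j e i * J i j * e j = 0.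

(** When J is the Hessian of P, [L] is the Laplacian of P, [B i] the i-th derivative of the right
    Dirac derivative of P, and [C j] the j-th derivative of the left one. *)
Let L := \sum_i J i i.
Let B i := \sum_j J i j * e j.
Let C j := \sum_i e i * J i j.

Let eB : \sum_i e i * B i = 0.
Proof.
rewrite -[RHS]infraJ; apply: eq_bigr => i _.
by rewrite mulr_sumr; apply: eq_bigr => j _; rewrite mulrA.
Qed.

Let Ce : \sum_j C j * e j = 0.
Proof.
rewrite -[RHS]infraJ [RHS]exchange_big; apply: eq_bigr => i _.
by rewrite mulr_suml.
Qed.

Let eC : \sum_i e i * C i = - L.
Proof. exact: sum_gen_genl. Qed.

Let Be : \sum_i B i * e i = - L.
Proof. exact: sum_gen_genr. Qed.

(** Moving [e k] outwards on both sides leaves a main term that vanishes by [eB]; the corrections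
    sum to 2 (- L - L + 2 L) = 0. *)
Lemma sum_sandwich_infra : \sum_i \sum_j e i * sandwich (J i j) * e j = 0.
Proof.
have -> : \sum_i \sum_j e i * sandwich (J i j) * e j =
  \sum_k \sum_i e i * e k * (\sum_j J i j * e k * e j).
  rewrite [RHS]exchange_big; apply: eq_bigr => i _.
  under [RHS]eq_bigr do rewrite mulr_sumr.
  rewrite [RHS]exchange_big; apply: eq_bigr => j _.
  by rewrite mulr_sumr mulr_suml; apply: eq_bigr => k _; rewrite !mulrA.
have inner k : \sum_i e i * e k * (\sum_j J i j * e k * e j) =
    (e k * C k + B k * e k + J k k *+ 2) *+ 2.
  under eq_bigr => i _ do rewrite sum_gen_anticommr -/(B i).
  rewrite sum_gen_anticomml.
  have -> : \sum_j e j * (- (B j * e k) - J j k *+ 2) = - (C k *+ 2).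
    under eq_bigr do rewrite mulrBr mulrN mulrA mulrnAr.
    by rewrite sumrB sumrN -mulr_suml eB mul0r oppr0 add0r sumrMnl.
  by rewrite mulrN opprK mulrnAr -mulNrn -mulrnDl opprB opprK addrA addrAC.
under eq_bigr do rewrite inner.
by rewrite sumrMnl !big_split /= eC Be -/L addrACA addNr addr0 mul0rn.
Qed.

(* The second derivatives at 0 of the Laplacian of x P x, when J i j are those of P. *)
Definition hess i j :=
  sandwich (J i j) *+ 2 + (e i * B j + e j * B i) *+ 2
  + (C i * e j + C j * e i) *+ 2 + (e i * L * e j + e j * L * e i).

(** Each group of terms of [hess] collapses to a multiple of L through [eB], [Ce], [eC] and [Be],
    except one that also leaves a double sandwich of L. *)
Lemma sum_gen_hess : \sum_i \sum_j e i * hess i j * e j =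
  L *+ (m ^ 2 + 6 * m + 8) - sandwich (sandwich L).
Proof.
have eeBe : \sum_i \sum_j e i * (e i * B j) * e j = L *+ m.
  under eq_bigr => i _.
    under eq_bigr => j _ do rewrite mulrA gen_sqr mulN1r mulNr.
    rewrite sumrN Be opprK.
    over.
  by rewrite sumr_const card_ord.
have eeBe' : \sum_i \sum_j e i * (e j * B i) * e j = L *+ 2.
  rewrite exchange_big /=.
  under eq_bigr => i _.
    rewrite -mulr_suml.
    under eq_bigr => j _ do rewrite mulrA.
    rewrite sum_gen_anticomml eB mulr0 oppr0 add0r mulNr mulrnAl.
    over.
  by rewrite sumrN sumrMnl Be mulNrn opprK.
have eCee : \sum_i \sum_j e i * (C i * e j) * e j = L *+ m.
  under eq_bigr => i _.
    under eq_bigr => j _.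
      rewrite -!mulrA gen_sqr mulrN1 mulrN.
      over.
    rewrite sumr_const card_ord.
    over.
  by rewrite sumrMnl sumrN eC opprK.
have eCee' : \sum_i \sum_j e i * (C j * e i) * e j = L *+ 2.
  under eq_bigr => i _.
    under eq_bigr do rewrite -mulrA.
    rewrite -mulr_sumr sum_gen_anticommr Ce mul0r oppr0 add0r mulrN mulrnAr.
    over.
  by rewrite sumrN sumrMnl eC mulNrn opprK.
have eeLee : \sum_i \sum_j e i * (e i * L * e j) * e j = L *+ (m ^ 2).
  under eq_bigr => i _.
    under eq_bigr => j _.
      rewrite !mulrA gen_sqr mulN1r -mulrA gen_sqr mulrN1 opprK.
      over.
    rewrite sumr_const card_ord.
    over.
  by rewrite sumr_const card_ord -mulrnA.
have eeLee' : \sum_i \sum_j e i * (e j * L * e i) * e j =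
    L *+ (2 * m) - sandwich (sandwich L).
  under eq_bigr => i _.
    under eq_bigr do rewrite mulrA.
    (* Exchanging [e i] with the last [e j] nests the sum over j inside the one over i. *)
    rewrite sum_gen_anticommr mulrA gen_sqr mulN1r mulNrn opprK.
    under eq_bigr do rewrite -mulrA.
    rewrite -mulr_sumr.
    over.
  by rewrite big_split sumrN sumr_const card_ord -mulrnA addrC.
have -> : \sum_i \sum_j e i * hess i j * e j =
  (\sum_i \sum_j e i * sandwich (J i j) * e j) *+ 2
  + (L *+ m + L *+ 2) *+ 2 + (L *+ m + L *+ 2) *+ 2
  + (L *+ (m ^ 2) + (L *+ (2 * m) - sandwich (sandwich L))).
  rewrite -{1}eeBe -{1}eeBe' -eCee -eCee' -eeLee -eeLee'.
  rewrite -!big_split -!sumrMnl -!big_split /=; apply: eq_bigr => i _.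
  rewrite -!big_split -!sumrMnl -!big_split /=; apply: eq_bigr => j _.
  by rewrite /hess !(mulrDr, mulrDl, mulrnAr, mulrnAl).
rewrite sum_sandwich_infra mul0rn add0r -!mulrnDr -!mulrnA !addrA.
by rewrite -!mulrnDr; congr (_ *+ _ - _); ring.
Qed.

Variable o : 'I_m.
Let l := tr (e o * L).
Let a := tr (B o).

Let tr_C : tr (C o) = a.
Proof.
rewrite /a /B /C !raddf_sum; apply: eq_bigr => j _ /=.
by rewrite trC symJ.
Qed.

(** The trace of the sum of e_j e_o C_j is computed twice: anticommutation gives l - 2 tr (C o),
    while cyclicity gives 0 by [Ce]. *)
Let la : l = a *+ 2.
Proof.
apply/eqP; rewrite -subr_eq0 -tr_C.
have <- : tr (\sum_j e j * e o * C j) = l - tr (C o) *+ 2.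
  by rewrite sum_gen_anticomml eC mulrN opprK raddfB raddfMn.
have -> : tr (\sum_j e j * e o * C j) =
    tr (e o * \sum_j C j * e j).
  rewrite mulr_sumr !raddf_sum; apply: eq_bigr => j _ /=.
  by rewrite -mulrA trC mulrA.
by rewrite Ce mulr0 raddf0.
Qed.

Lemma tr_hess_gen :
  tr (\sum_j hess o j * e j) = - (l *+ (3 * m + 6)).
Proof.
(* Self-adjointness moves the sandwich onto [e j], where it acts as m - 2. *)
have SJ : tr (\sum_j sandwich (J o j) * e j) = a *+ m - a *+ 2.
  rewrite /a /B !raddf_sum -!sumrMnl -sumrB; apply: eq_bigr => j _ /=.
  rewrite trC tr_sandwich sandwich_gen mulrBl !mulrnAl.
  by rewrite raddfB !raddfMn /= trC.
have eBe : tr (\sum_j e o * B j * e j) = - l.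
  under eq_bigr do rewrite -mulrA.
  by rewrite -mulr_sumr Be mulrN raddfN.
have Cee : tr (\sum_j C o * e j * e j) = - (a *+ m).
  under eq_bigr do rewrite -mulrA.
  by rewrite -mulr_sumr sum_gen_sqr mulrN mulr_natr raddfN raddfMn /= tr_C.
have Cee' : tr (\sum_j C j * e o * e j) = - (a *+ 2).
  by rewrite sum_gen_anticommr Ce mul0r oppr0 add0r raddfN raddfMn /= tr_C.
have eLee : tr (\sum_j e o * L * e j * e j) = - (l *+ m).
  under eq_bigr do rewrite -mulrA.
  by rewrite -mulr_sumr sum_gen_sqr mulrN mulr_natr raddfN raddfMn.
have eLee' : tr (\sum_j e j * L * e o * e j) = - (l *+ m).
  under eq_bigr do rewrite -(mulrA (e _) L).
  by rewrite tr_sandwich1 trC.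
have -> : \sum_j hess o j * e j =
  (\sum_j sandwich (J o j) * e j) *+ 2
  + ((\sum_j e o * B j * e j) + sandwich (B o)) *+ 2
  + ((\sum_j C o * e j * e j) + (\sum_j C j * e o * e j)) *+ 2
  + ((\sum_j e o * L * e j * e j) + (\sum_j e j * L * e o * e j)).
  rewrite -!big_split -!sumrMnl -!big_split /=; apply: eq_bigr => j _.
  by rewrite /hess !(mulrDl, mulrnAl).
rewrite !(raddfD, raddfMn) /= SJ eBe tr_sandwich1 -/a Cee Cee' eLee eLee'.
by rewrite la; ring.
Qed.

(** Both traces are multiples of l: the first is (m^2 + 6m + 8) - (m - 2)^2 = 10m + 4 times l, the
    second - (3m + 6) times l. The weights are these factors, exchanged so that the terms cancel. *)
Lemma tr_hess_relation :
  tr (e o * \sum_i \sum_j e i * hess i j * e j) *+ (3 * m + 6)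
  + tr (\sum_j hess o j * e j) *+ (10 * m + 4) = 0.
Proof.
have trSS : tr (e o * sandwich (sandwich L)) =
    (l *+ m - l *+ 2) *+ m - (l *+ m - l *+ 2) *+ 2.
  rewrite !tr_sandwich sandwich_gen.
  have sandwichMn x n : sandwich (x *+ n) = sandwich x *+ n.
    by rewrite -sumrMnl; apply: eq_bigr => i _; rewrite mulrnAr mulrnAl.
  have sandwichB x y : sandwich (x - y) = sandwich x - sandwich y.
    by rewrite -sumrB; apply: eq_bigr => i _; rewrite mulrBr mulrBl.
  rewrite sandwichB !sandwichMn sandwich_gen !(mulrBl, mulrnAl).
  by rewrite !(raddfB, raddfMn) /= -/l; ring.
rewrite tr_hess_gen sum_gen_hess mulrBr mulrnAr raddfB raddfMn /= trSS -/l.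
by ring.
Qed.

End Symmetric.
End AnticommutingGenerators.

(** * Second derivatives at the origin and the obstruction functional *)

Section PolynomialHessian.
Variables (A : nzRingType) (m : nat).
Implicit Types P Q : {mpoly A[m]}.

Lemma mcoeff0M P Q : (P * Q)@_0 = P@_0 * Q@_0.
Proof. by have [] := @mcoeff0_is_multiplicative m A. Qed.

Lemma mderiv_sum (I : finType) (F : I -> {mpoly A[m]}) i :
  (\sum_k F k)^`M(i) = \sum_k (F k)^`M(i).
Proof. exact: (big_morph _ (mderivD i) (mderiv0 _ i)). Qed.

Definition hessian0 P i j := (P^`M(i)^`M(j))@_0.

Lemma hessian0C P i j : hessian0 P i j = hessian0 P j i.
Proof. by rewrite /hessian0 mderiv_comm. Qed.

Variables (e : 'I_m -> A) (X : {mpoly A[m]}).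
Hypotheses (dX : forall i, X^`M(i) = (e i)%:MP) (X0 : X@_0 = 0).

Lemma mderiv_mulCC c d P i :
  (c%:MP * P * d%:MP)^`M(i) = c%:MP * P^`M(i) * d%:MP.
Proof. by rewrite mderivM mderiv_mulC mderivC mulr0 addr0. Qed.

Lemma mderiv_mulCX c P i :
  (c%:MP * P * X)^`M(i) = c%:MP * P^`M(i) * X + c%:MP * P * (e i)%:MP.
Proof. by rewrite mderivM mderiv_mulC dX. Qed.

Lemma mderiv_mulXC P d i :
  (X * P * d%:MP)^`M(i) = (e i)%:MP * P * d%:MP + X * P^`M(i) * d%:MP.
Proof. by rewrite mderivM mderivC mulr0 addr0 mderivM dX mulrDl. Qed.

Lemma mderiv_mulXX P i :
  (X * P * X)^`M(i) =
  (e i)%:MP * P * X + X * P^`M(i) * X + X * P * (e i)%:MP.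
Proof. by rewrite mderivM mderivM !dX mulrDl. Qed.

(** Since X has constant first derivatives, its second derivatives drop out of the Leibniz
    expansion, and the mixed terms occur in equal pairs. *)
Lemma laplacian_sandwich P : \sum_k (X * P * X)^`M(k)^`M(k) =
  \sum_k ((e k)%:MP * P * (e k)%:MP *+ 2 + (e k)%:MP * P^`M(k) * X *+ 2
    + X * P^`M(k) * (e k)%:MP *+ 2 + X * P^`M(k)^`M(k) * X).
Proof.
apply: eq_bigr => k _.
rewrite mderiv_mulXX !mderivD mderiv_mulXX mderiv_mulCX mderiv_mulXC !mulr2n.
by rewrite [LHS](AC (2*3*2) ((2*6)*(1*3)*(5*7)*4)).
Qed.

Lemma mcoeff0_mulCC c d P : (c%:MP * P * d%:MP)@_0 = c * P@_0 * d.
Proof. by rewrite !mcoeff0M !mpolyCK. Qed.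

Lemma mcoeff0_mulCX c P : (c%:MP * P * X)@_0 = 0.
Proof. by rewrite mcoeff0M X0 mulr0. Qed.

Lemma mcoeff0_mulXC P c : (X * P * c%:MP)@_0 = 0.
Proof. by rewrite mcoeff0M mcoeff0M X0 !mul0r. Qed.

Lemma mcoeff0_mulXX P : (X * P * X)@_0 = 0.
Proof. by rewrite mcoeff0M X0 mulr0. Qed.

Lemma hessian0_mulCC c d P i j :
  hessian0 (c%:MP * P * d%:MP) i j = c * hessian0 P i j * d.
Proof. by rewrite /hessian0 !mderiv_mulCC mcoeff0_mulCC. Qed.

(** X vanishes at 0, so here and in the next two lemmas only those Leibniz terms survive in which
    every factor X is differentiated. *)
Lemma hessian0_mulCX c P i j : hessian0 (c%:MP * P * X) i j =
  c * (P^`M(j))@_0 * e i + c * (P^`M(i))@_0 * e j.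
Proof.
rewrite /hessian0 mderiv_mulCX mderivD mderiv_mulCX mderiv_mulCC.
by rewrite !mcoeffD mcoeff0_mulCX !mcoeff0_mulCC add0r addrC.
Qed.

Lemma hessian0_mulXC c P i j : hessian0 (X * P * c%:MP) i j =
  e i * (P^`M(j))@_0 * c + e j * (P^`M(i))@_0 * c.
Proof.
rewrite /hessian0 mderiv_mulXC mderivD mderiv_mulXC mderiv_mulCC.
by rewrite !mcoeffD mcoeff0_mulXC !mcoeff0_mulCC addr0.
Qed.

Lemma hessian0_mulXX P i j : hessian0 (X * P * X) i j =
  e i * P@_0 * e j + e j * P@_0 * e i.
Proof.
rewrite /hessian0 mderiv_mulXX !mderivD mderiv_mulCX mderiv_mulXX mderiv_mulXC.
rewrite !mcoeffD mcoeff0_mulCX !mcoeff0_mulXX !mcoeff0_mulXC mcoeff0_mulCX.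
by rewrite !mcoeff0_mulCC !add0r !addr0.
Qed.

Lemma hessian0D P Q i j : hessian0 (P + Q) i j = hessian0 P i j + hessian0 Q i j.
Proof. by rewrite /hessian0 !mderivD mcoeffD. Qed.

Lemma hessian0_sum (I : finType) (F : I -> {mpoly A[m]}) i j :
  hessian0 (\sum_k F k) i j = \sum_k hessian0 (F k) i j.
Proof.
apply: (big_morph (fun P => hessian0 P i j)) => [P Q|]; first exact: hessian0D.
by rewrite /hessian0 !mderiv0 mcoeff0.
Qed.

(** In each term of [laplacian_sandwich] the remaining factors X absorb just enough derivatives to
    leave exactly two on P; hence only the Hessian of P at 0 enters. *)
Lemma hessian0_laplacian_sandwich P i j :
  hessian0 (\sum_k (X * P * X)^`M(k)^`M(k)) i j = hess e (hessian0 P) i j.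
Proof.
rewrite /hess /sandwich laplacian_sandwich hessian0_sum.
rewrite !mulr_sumr !mulr_suml -!big_split -!sumrMnl -!big_split /=.
apply: eq_bigr => k _.
rewrite !hessian0D hessian0_mulCC hessian0_mulCX hessian0_mulXC.
rewrite hessian0_mulXX -/(hessian0 P k j) -/(hessian0 P k i) -/(hessian0 P k k).
rewrite !mulrA (hessian0C P j k) (hessian0C P i k) !mulr2n.
by rewrite (addrC (e k * hessian0 P k j * e i)) [LHS](AC 4 (1*3*2*4)).
Qed.

(** The inframonogenic equation without the degree condition, so that it passes to partial
    derivatives. *)
Definition dirac_null P :=
  \sum_i \sum_j (e i)%:MP * P^`M(j)^`M(i) * (e j)%:MP = 0.

Lemma dirac_null_mderiv P k : dirac_null P -> dirac_null P^`M(k).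
Proof.
move=> DP0; rewrite /dirac_null -[RHS](mderiv0 _ k) -[in RHS]DP0.
rewrite mderiv_sum; apply: eq_bigr => i _.
rewrite mderiv_sum; apply: eq_bigr => j _.
by rewrite mderiv_mulCC !(mderiv_comm k).
Qed.

Lemma hessian0_dirac_null P :
  dirac_null P -> \sum_i \sum_j e i * hessian0 P i j * e j = 0.
Proof.
move=> DP0; rewrite -[RHS](@mcoeff0 m A 0%MM) -[in RHS]DP0.
rewrite raddf_sum; apply: eq_bigr => i _.
rewrite raddf_sum; apply: eq_bigr => j _ /=.
by rewrite mcoeff0_mulCC hessian0C.
Qed.

Lemma hessian0_laplacian_dirac_null P : dirac_null P ->
  \sum_i \sum_j e i * hessian0 (\sum_k P^`M(k)^`M(k)) i j * e j = 0.
Proof.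
move=> DP0.
under eq_bigr => i _.
  under eq_bigr do rewrite hessian0_sum mulr_sumr mulr_suml.
  rewrite exchange_big.
  over.
rewrite exchange_big big1 //= => k _.
by apply: hessian0_dirac_null; do 2!apply: dirac_null_mderiv.
Qed.

Hypotheses (mulr2I : injective (fun x : A => x *+ 2))
  (e_anticomm : forall i j, e i * e j = - (e j * e i) - (i == j)%:R *+ 2).

Lemma hessian0_laplacian_genr P o : dirac_null P ->
  \sum_j hessian0 (\sum_k P^`M(k)^`M(k)) o j * e j = 0.
Proof.
(* Swapping the two pairs of derivatives makes the Laplacian a trace over the last two indices of a
   fourth-derivative family, as [sum_trace_genr] expects. *)
move=> DP0; have comm4 Q a b c d :
  hessian0 (Q^`M(a)^`M(b)) c d = hessian0 (Q^`M(c)^`M(d)) a b.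
  rewrite /hessian0 (mderiv_comm b c) (mderiv_comm a c) (mderiv_comm b d).
  by rewrite (mderiv_comm a d).
under eq_bigr => j _.
  rewrite hessian0_sum; under eq_bigr do rewrite comm4.
  over.
pose T j := hessian0 (P^`M(o)^`M(j)).
apply: (sum_trace_genr mulr2I e_anticomm (T := T)) => [j i k|k].
  exact: hessian0C.
rewrite -[RHS](@hessian0_dirac_null P^`M(o)^`M(k)); last first.
  by do 2!apply: dirac_null_mderiv.
apply: eq_bigr => i _; apply: eq_bigr => j _; congr (_ * _ * _).
by rewrite /T /hessian0 (mderiv_comm j i) (mderiv_comm j k) (mderiv_comm i k).
Qed.

Variables (R : comNzRingType) (tr : {additive A -> R}).
Hypothesis trC : forall x y, tr (x * y) = tr (y * x).

(* For P homogeneous of degree 4 this is, up to a factor, the Fischer inner product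
   of P with x N x, where N = (3 m + 6) |x|^2 e_o - (10 m + 4) x_o x. *)
Definition obstruction (o : 'I_m) P (H := hessian0 (\sum_k P^`M(k)^`M(k))) : R :=
  tr (e o * \sum_i \sum_j e i * H i j * e j) *+ (3 * m + 6)
  + tr (\sum_j H o j * e j) *+ (10 * m + 4).

Lemma obstructionD o P Q :
  obstruction o (P + Q) = obstruction o P + obstruction o Q.
Proof.
rewrite /obstruction; set H := hessian0 _; set HP := hessian0 _; set HQ := hessian0 _.
have HE i j : H i j = HP i j + HQ i j.
  rewrite -hessian0D -big_split; congr hessian0.
  by apply: eq_bigr => k _; rewrite !mderivD.
rewrite addrACA -!mulrnDl -!raddfD -mulrDr -!big_split /=.
congr (tr (_ * _) *+ _ + tr _ *+ _); apply: eq_bigr => i _.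
  by rewrite -big_split /=; apply: eq_bigr => j _; rewrite HE mulrDr mulrDl.
by rewrite HE mulrDl.
Qed.

(** The Laplacian of P is again null, which kills the first trace; its right Dirac derivative has
    zero gradient at 0, which kills the second. *)
Lemma obstruction_dirac_null o P : dirac_null P -> obstruction o P = 0.
Proof.
move=> DP0; rewrite /obstruction hessian0_laplacian_dirac_null //.
by rewrite hessian0_laplacian_genr // mulr0 !raddf0 !mul0rn addr0.
Qed.

Lemma obstruction_sandwich o P : dirac_null P -> obstruction o (X * P * X) = 0.
Proof.
move=> DP0; rewrite /obstruction; set H := hessian0 _.
have HE i j : H i j = hess e (hessian0 P) i j by apply: hessian0_laplacian_sandwich.
under eq_bigr do under eq_bigr do rewrite HE.
under [\sum_j H o j * e j]eq_bigr do rewrite HE.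
apply: tr_hess_relation => //; first exact: hessian0C.
exact: hessian0_dirac_null.
Qed.

(** * The biharmonic monomial and its obstruction *)

Lemma mderivU i j : ('X_i : {mpoly A[m]})^`M(j) = (i == j)%:R.
Proof.
rewrite mderivX mnm1E; have [->|_] := eqVneq i j; last by rewrite scale0r.
by rewrite -[X in (X - _)%MM]add0m addmK scale1r mpolyX0.
Qed.

Lemma laplacian_mulC c P : \sum_k (c%:MP * P)^`M(k)^`M(k) =
  c%:MP * \sum_k P^`M(k)^`M(k).
Proof. by rewrite mulr_sumr; apply: eq_bigr => k _; rewrite !mderiv_mulC. Qed.

Lemma mderiv_natr n k : (n%:R : {mpoly A[m]})^`M(k) = 0.
Proof. by rewrite -mpolyC_nat mderivC. Qed.

Lemma laplacian_mulU i j : i != j ->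
  \sum_k ('X_i * 'X_j : {mpoly A[m]})^`M(k)^`M(k) = 0.
Proof.
move=> neq_ij; rewrite big1 // => k _.
rewrite mderivM mderivD !mderivM !mderivU !mderiv_natr mul0r mulr0 add0r addr0.
have [<-|_] := eqVneq i k; last by rewrite !mul0r addr0.
by rewrite [j == i]eq_sym (negbTE neq_ij) !mulr0 addr0.
Qed.

Lemma laplacian_mulU3 i j : i != j ->
  \sum_k ('X_i ^+ 3 * 'X_j : {mpoly A[m]})^`M(k)^`M(k) = 'X_i * 'X_j *+ 6.
Proof.
move=> neq_ij; rewrite (bigD1 i) //= big1 ?addr0 => [|k neq_ki].
  have dX2 : ('X_i ^+ 2 : {mpoly A[m]})^`M(i) = 'X_i *+ 2.
    by rewrite expr2 mderivM mderivU eqxx mul1r mulr1.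
  have dX3 : ('X_i ^+ 3 : {mpoly A[m]})^`M(i) = 'X_i ^+ 2 *+ 3.
    by rewrite exprS mderivM dX2 mderivU eqxx mul1r mulrnAr -expr2 -mulrS.
  have dXj P : (P * 'X_j)^`M(i) = P^`M(i) * 'X_j.
    by rewrite mderivM mderivU eq_sym (negbTE neq_ij) mulr0 addr0.
  by rewrite !dXj dX3 mderivMn dX2 -mulrnA mulrnAl.
rewrite mderivM !exprS expr0 mulr1 !mderivM !mderivU.
rewrite eq_sym (negbTE neq_ki) !(mul0r, mulr0, add0r).
by rewrite !mderivM !mderivU mderiv_natr eq_sym (negbTE neq_ki) !(mul0r, mulr0, add0r).
Qed.

Lemma bilaplacian_monomial (c : A) (i j : 'I_m) : i != j ->
  \sum_l (\sum_k (c%:MP * ('X_i ^+ 3 * 'X_j))^`M(k)^`M(k))^`M(l)^`M(l) = 0.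
Proof.
move=> neq_ij; rewrite laplacian_mulC laplacian_mulU3 // laplacian_mulC.
under eq_bigr do rewrite !mderivMn.
by rewrite sumrMnl laplacian_mulU // mul0rn mulr0.
Qed.

Lemma sum_gen_delta x i j :
  \sum_a \sum_b e a * (x *+ ((i == a) && (j == b))) * e b = e i * x * e j.
Proof.
rewrite (bigD1 i) //= [X in _ + X]big1 ?addr0 => [|a].
  rewrite (bigD1 j) //= big1 ?addr0 => [|b]; first by rewrite !eqxx.
  by rewrite eq_sym andbC => /negbTE->; rewrite mulr0 mul0r.
rewrite eq_sym => /negbTE neq_ai; rewrite big1 // => b _.
by rewrite neq_ai mulr0 mul0r.
Qed.

(** The Laplacian is 6 x_i x_j e_j, with Hessian entries 6 e_j at (i, j) and (j, i). The traces are
    12 and -6 times tr 1, and 12 (3m + 6) - 6 (10m + 4) = 48 - 24m. *)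
Lemma obstruction_monomial i j : i != j ->
  obstruction i ((e j)%:MP * ('X_i ^+ 3 * 'X_j)) =
  tr 1 *+ 48 - tr 1 *+ (24 * m).
Proof.
move=> neq_ij; rewrite /obstruction laplacian_mulC laplacian_mulU3 //.
set H := hessian0 _.
have HE a b : H a b = e j *+ 6 *+ ((i == a) && (j == b))
                      + e j *+ 6 *+ ((j == a) && (i == b)).
  rewrite /H /hessian0 !mderiv_mulC !mderivMn mderivM mderivD !mderivM !mderivU.
  rewrite !mderiv_natr mul0r mulr0 add0r addr0 -!natrM -natrD !mulnb.
  rewrite mcoeffCM mcoeffMn -mpolyC_nat mpolyCK mulrnAr mulr_natr -mulrnDr.
  by rewrite mulrnAC [(i == b) && _]andbC.
have e2 := gen_sqr mulr2I e_anticomm.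
have -> : \sum_a \sum_b e a * H a b * e b = - e i *+ 12.
  under eq_bigr do under eq_bigr do rewrite HE mulrDr mulrDl.
  under eq_bigr do rewrite big_split.
  rewrite big_split /= !sum_gen_delta !mulrnAr !mulrnAl.
  by rewrite -(mulrA (e i)) (e2 j) mulrN1 mulN1r -mulrnDr.
have -> : \sum_b H i b * e b = - 1 *+ 6.
  rewrite (bigD1 j) //= big1 ?addr0 => [|b neq_bj].
    rewrite HE !eqxx [j == i]eq_sym (negbTE neq_ij) andTb andFb mulr1n mulr0n.
    by rewrite addr0 mulrnAl e2.
  rewrite HE [j == b]eq_sym (negbTE neq_bj) [j == i]eq_sym (negbTE neq_ij).
  by rewrite andbF andFb !mulr0n addr0 mul0r.
rewrite mulrnAr mulrN e2 opprK mulNrn raddfN !raddfMn /=; ring.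
Qed.

Lemma monomial_decomposition i j P Q : i != j -> dirac_null P -> dirac_null Q ->
  (e j)%:MP * ('X_i ^+ 3 * 'X_j) = P + X * Q * X -> tr 1 *+ 48 = tr 1 *+ (24 * m).
Proof.
move=> neq_ij DP0 DQ0 /(congr1 (obstruction i)).
rewrite obstruction_monomial // obstructionD obstruction_dirac_null //.
by rewrite obstruction_sandwich // addr0 => /eqP; rewrite subr_eq0 => /eqP.
Qed.

End PolynomialHessian.

(** * The standard basis as a structural set *)

Section StandardVariable.
Variables (R : numFieldType) (m : nat).
Local Notation Pol := (clifford_poly R m).
Local Notation e := (@clifford_gen R m).
Implicit Types P : Pol.

Definition std_basis (i : 'I_m) : 'rV[R]_m := delta_mx 0 i.
Local Notation X := (xvar std_basis).

Lemma clifford_vec_std i : clifford_vec (std_basis i) = e i.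
Proof.
rewrite /clifford_vec (bigD1 i) //= mxE !eqxx scale1r big1 ?addr0 // => j neq.
by rewrite mxE (negbTE neq) andbF scale0r.
Qed.

Lemma structural_std : structural_set std_basis.
Proof.
split=> [|i j]; last first.
  by rewrite trmx_delta mul_delta_mx_cond; case: (i == j); rewrite !mxE.
rewrite basisEdim size_map -cardE card_ord dimvf /dim /= mul1n leqnn andbT.
apply/subvP => v _; rewrite (row_sum_delta v).
by apply: memv_suml => i _; apply/memvZ/memv_span/map_f; rewrite mem_enum.
Qed.

Lemma mderiv_xvar_std i : X^`M(i) = (e i)%:MP.
Proof.
rewrite raddf_sum (bigD1 i) //= big1 ?addr0 => [|j neq_ji].
  by rewrite mderiv_mulC mderivU eqxx mulr1 clifford_vec_std.
by rewrite mderiv_mulC mderivU (negbTE neq_ji) mulr0.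
Qed.

Lemma mcoeff0_xvar : X@_0 = 0.
Proof.
rewrite raddf_sum big1 // => i _ /=.
by rewrite mcoeff0M mcoeffX mnm1_eq0 mulr0.
Qed.

Lemma inframonogenic_dirac_null k P :
  inframonogenic std_basis std_basis k P -> dirac_null e P.
Proof.
move=> [_ DP0]; rewrite /dirac_null -[RHS]DP0.
by do 2!apply: eq_bigr => ? _; rewrite !clifford_vec_std.
Qed.

End StandardVariable.

Theorem mainTheorem1 (R : realType) :
  ~ (forall (m : nat) (phi psi : 'I_m -> 'rV[R]_m) (k : nat),
       (0 < m)%N -> structural_set phi -> structural_set psi -> (2 <= k)%N ->
       forall B : clifford_poly R m, biharmonic k B ->
       exists! I : clifford_poly R m * clifford_poly R m,
         [/\ inframonogenic phi psi k I.1,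
             inframonogenic phi psi (k - 2)%N I.2
           & B = I.1 + xvar phi * I.2 * xvar psi]).
Proof.
move=> decomposition.
pose i0 : 'I_3 := ord0; pose i1 : 'I_3 := lift ord0 ord0.
pose e := @clifford_gen R 3; pose phi := @std_basis R 3.
pose tr : {additive clifford R 3 -> R} := @clifford_tr R 3.
pose B : clifford_poly R 3 := (e i1)%:MP * ('X_i0 ^+ 3 * 'X_i1).
have neq01 : i0 != i1 by [].
have bihB : biharmonic 4 B.
  split.
    rewrite /B mul_mpolyC rpredZ // (_ : 4 = 1 * 3 + 1)%N //.
    by apply: dhomogM; [apply: dhomogMn|]; rewrite dhomogX /= mdeg1.
  exact: bilaplacian_monomial.
have std := structural_std R 3.
have [[I4 I2] /=] := decomposition 3 phi phi 4 isT std std isT B bihB.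
case=> [[/inframonogenic_dirac_null D4 /inframonogenic_dirac_null D2 defB] _].
have := @monomial_decomposition _ _ e (xvar phi)
  (@mderiv_xvar_std R 3) (mcoeff0_xvar R 3) (@clifford_mulr2I R 3)
  (@clifford_gen_anticomm R 3) _ tr (@clifford_trC R 3) i0 i1 I4 I2 neq01 D4 D2 defB.
have -> : tr 1 = 1 := clifford_tr1 R 3.
(* For m = 3 the relation reads 48 = 72, impossible in characteristic 0. *)
by move/eqP; rewrite eqr_nat.
Qed.
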